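(* Let $\{\mathcal{P}_n\}_{n=1}^\infty$ be a sequence of pyramids. Then the following (1) and (2) are equivalent to each other. (1) $\{\mathcal{P}_n\}$ has the phase transition property. (2) There exists a sequence $\{r_n\}_{n=1}^\infty$ of positive real numbers such that $\operatorname{ObsDiam}(\mathcal{P}_n;-\kappa)\sim r_n$ for any $\kappa$ with $0<\kappa<1$, where $a_n\sim b_n$ means that the ratios $a_n/b_n$ and $b_n/a_n$ are bounded. In this case, $\{1/r_n\}$ is a sequence of critical scale order.
   Context: An mm-space is a triple $(X,d_X,\mu_X)$ with $(X,d_X)$ a complete separable metric space and $\mu_X$ a Borel probability measure; we always assume $X=\operatorname{supp}\mu_X$. $\mathcal{X}$ is the set of mm-isomorphism classes of mm-spaces (mm-isomorphism: measure-preserving isometry between supports). $Y\prec X$ means there is a $1$-Lipschitz map $f:X\to Y$ with $f_*\mu_X=\mu_Y$. Box distance: a parameter of $X$ is a Borel map $\varphi:I=[0,1)\to X$ with $\varphi_*\mathcal{L}^1=\mu_X$, where $\mathcal{L}^1$ is the Lebesgue measure on $I$. $\square(X,Y)$ is the infimum of $\varepsilon\ge0$ such that there are parameters $\varphi$ of $X$, $\psi$ of $Y$ and a Borel set $I_0\subset I$ with $\mathcal{L}^1(I_0)\ge1-\varepsilon$ and $|d_X(\varphi(s),\varphi(t))-d_Y(\psi(s),\psi(t))|\le\varepsilon$ for all $s,t\in I_0$. It is a metric on $\mathcal{X}$. A pyramid is a nonempty $\square$-closed subset $\mathcal{P}\subset\mathcal{X}$ such that (i) $X\in\mathcal{P}$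 and $Y\prec X$ imply $Y\in\mathcal{P}$; (ii) for any $X,X'\in\mathcal{P}$ there is $Y\in\mathcal{P}$ with $X\prec Y$, $X'\prec Y$. For $t>0$, $tX$ is $X$ with metric $t\,d_X$, and $t\mathcal{P}=\{tX\mid X\in\mathcal{P}\}$. Observable diameter: for a Borel probability measure $\nu$ on a metric space and $\alpha\in\mathbb{R}$, $\operatorname{diam}(\nu;\alpha)$ is the infimum of $\operatorname{diam}(A)$ over Borel sets $A$ with $\nu(A)\ge\alpha$. For an mm-space $X$ and $\kappa>0$, $\operatorname{ObsDiam}(X;-\kappa)=\sup\{\operatorname{diam}(f_*\mu_X;1-\kappa)\mid f:X\to\mathbb{R}\text{ is }1\text{-Lipschitz}\}$. For a pyramid, $\operatorname{ObsDiam}(\mathcal{P};-\kappa)=\lim_{\delta\to0+}\sup_{X\in\mathcal{P}}\operatorname{ObsDiam}(X;-(\kappa+\delta))\in[0,+\infty]$. Separation distance: for an mm-space $X$ and $\kappa_0,\dots,\kappa_N>0$, $N\ge1$, $\operatorname{Sep}(X;\kappa_0,\dots,\kappa_N)$ is the supremum of $\min_{i\ne j}d_X(A_i,A_j)$ over Borel sets $A_0,\dots,A_N\subset X$ with $\mu_X(A_i)\ge\kappa_i$ for all $i$, where $d_X(A,B)=\inf_{x\in A,y\in B}d_X(x,y)$; it is $0$ if no such sets exist. For a pyramid, $\operatorname{Sep}(\mathcal{P};\kappa_0,\dots,\kappa_N)=\lim_{\delta\to0+}\sup_{X\in\mathcal{P}}\operatorname{Sep}(X;\kappa_0-\delta,\dots,\kappa_N-\delta)\in[0,+\infty]$.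 A sequence of pyramids $\{\mathcal{Q}_n\}$ is a Lévy family if $\lim_{n\to\infty}\operatorname{Sep}(\mathcal{Q}_n;\kappa_0,\kappa_1)=0$ for all $\kappa_0,\kappa_1>0$ with $\kappa_0+\kappa_1<1$. It $\infty$-dissipates if $\lim_{n\to\infty}\operatorname{Sep}(\mathcal{Q}_n;\kappa_0,\dots,\kappa_N)=+\infty$ for all $\kappa_0,\dots,\kappa_N>0$ with $\sum_{i=0}^N\kappa_i<1$. $\{\mathcal{P}_n\}$ has the phase transition property if there is a sequence of positive real numbers $c_n$ such that for every sequence of positive real numbers $t_n$: if $t_n/c_n\to0$ then $\{t_n\mathcal{P}_n\}$ is a Lévy family, and if $t_n/c_n\to+\infty$ then $\{t_n\mathcal{P}_n\}$ $\infty$-dissipates. Such a sequence $\{c_n\}$ is called a sequence of critical scale order.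
   Formalization: The relation a_n ~ b_n is taken to mean that both ratios are bounded for all sufficiently large n (depending on κ), since with boundedness for all n, (1)⇒(2) fails when, e.g., P_1 is the one-point pyramid, whose observable diameter is 0. *)

(* Defs.v *)
From HB Require Import structures.
From mathcomp Require Import all_boot all_order all_algebra.
From mathcomp Require Import all_classical all_reals all_analysis.

Set Implicit Arguments.
Unset Strict Implicit.
Unset Printing Implicit Defensive.

Import Order.TTheory GRing.Theory Num.Theory.
Import numFieldTopology.Exports.

Local Open Scope classical_set_scope.
Local Open Scope ring_scope.

(* The base point required by [Complete] (and by measurable types) is harmless:
   carriers of probability measures are nonempty, and no definition below
   depends on it. *)
#[short(type="completeMetricType")]
HB.structure Definition CompleteMetric (R : numDomainType) :=
  { T of Metric R T & Complete T }.

Notation borel T := (g_sigma_algebraType (@open T)).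

Section Metric.
Context {R : realType}.
Local Open Scope ereal_scope.

Definition separable (T : topologicalType) :=
  exists D : set T, countable D /\ dense D.

Definition one_lipschitz (S T : metricType R) (f : S -> T) :=
  forall x y, (mdist (f x) (f y) <= mdist x y)%R.

(* [maxe 0] only matters for the empty set, whose diameter is 0. *)
Definition diam (T : metricType R) (A : set T) : \bar R :=
  maxe 0 (ereal_sup [set (mdist x y)%:E | x in A & y in A]).

Definition set_dist (T : metricType R) (A B : set T) : \bar R :=
  ereal_inf [set (mdist x y)%:E | x in A & y in B].

Definition partial_diam (T : metricType R) (nu : set T -> \bar R) (alpha : R) :
    \bar R :=
  ereal_inf [set diam A | A in [set A | <<s open >> A /\ alpha%:E <= nu A]].

Definition supp (T : completeMetricType R) (mu : set T -> \bar R) : set T :=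
  [set x | forall U, open_nbhs x U -> 0 < mu U].

End Metric.

Record mmspace (R : realType) := MMSpace {
  mm_carrier :> completeMetricType R ;
  mm_measure : probability (borel mm_carrier) R ;
  mm_separable : separable mm_carrier ;
  mm_full_support : supp mm_measure = setT }.

Section MMSpace.
Context {R : realType}.
Implicit Types X Y : mmspace R.

Definition measure_preserving X Y (f : X -> Y) :=
  forall A : set (borel Y), measurable A ->
    pushforward (mm_measure X) (f : borel X -> borel Y) A = mm_measure Y A.

Definition mm_isomorphic X Y := exists f : X -> Y,
  [/\ bijective f, forall x y, mdist (f x) (f y) = mdist x y
    & measure_preserving f].

(* [lipschitz_order Y X] is Y \prec X. *)
Definition lipschitz_order Y X := exists f : X -> Y,
  one_lipschitz f /\ measure_preserving f.

(* A parameter is defined on [0, 1[ only; it is represented by a total function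
   whose values outside [0, 1[ are irrelevant. *)
Definition parameter X (phi : R -> X) :=
  measurable_fun (`[0, 1[%classic : set R) (phi : R -> borel X) /\
  forall A : set (borel X), measurable A ->
    lebesgue_measure (`[0, 1[%classic `&` phi @^-1` A) = mm_measure X A.

Definition box X Y : \bar R :=
  ereal_inf [set e%:E | e in [set e : R | 0 <= e /\
    exists (phi : R -> X) (psi : R -> Y) (I0 : set R),
      [/\ parameter phi, parameter psi, I0 `<=` `[0, 1[%classic,
          measurable I0 &
          ((1 - e)%:E <= lebesgue_measure I0)%E /\
          forall s t, I0 s -> I0 t ->
            `|mdist (phi s) (phi t) - mdist (psi s) (psi t)| <= e]]].

Definition obs_diam X (kappa : R) : \bar R :=
  ereal_sup [set partial_diam
      (pushforward (mm_measure X) (f : borel X -> borel R^o)) (1 - kappa)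
    | f in [set f : X -> R^o | one_lipschitz f]].

(* [maxe 0] accounts for the convention that the value is 0 when no family A
   exists; the other candidate values are nonnegative. *)
Definition sep X (N : nat) (kappa : 'I_N.+1 -> R) : \bar R :=
  maxe 0%E (ereal_sup
    [set \big[mine/+oo%E]_(p : 'I_N.+1 * 'I_N.+1 | p.1 != p.2)
           set_dist (A p.1) (A p.2)
     | A in [set A : 'I_N.+1 -> set X | forall i,
              measurable (A i : set (borel X)) /\
              ((kappa i)%:E <= mm_measure X (A i))%E]]).

End MMSpace.

(* [scaled t T] is T with the metric multiplied by t; the uniform structure,
   hence the topology and the Borel sets, are those of T. *)
Definition scaled (R : realType) (t : {posnum R}) (T : Type) : Type := T.

Section Scaled.
Context {R : realType} (t : {posnum R}) (T : completeMetricType R).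

HB.instance Definition _ := Complete.copy (scaled t T) T.

Let sball (x : scaled t T) (e : R) : set (scaled t T) :=
  ball (x : T) (e / t%:num).

Let sball_center x (e : R) : 0 < e -> sball x e x.
Proof. by move=> e0; apply: ball_center_subproof; rewrite divr_gt0. Qed.

Let sball_sym x y (e : R) : sball x e y -> sball y e x.
Proof. exact: ball_sym. Qed.

Let sball_triangle x y z (e1 e2 : R) :
  sball x e1 y -> sball y e2 z -> sball x (e1 + e2) z.
Proof. by rewrite /sball mulrDl; exact: ball_triangle. Qed.

Let sentourageE : @entourage (scaled t T) = entourage_ sball.
Proof.
rewrite -[LHS]/(@entourage T) -entourage_ballE.
apply/seteqP; split => A [e /= e0 eA].
  exists (e * t%:num) => /=; first by rewrite mulr_gt0.
  by move=> xy; rewrite /sball /= mulfK// => /eA.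
exists (e / t%:num) => /=; first by rewrite divr_gt0.
by move=> xy xye; apply: eA.
Qed.

HB.instance Definition _ := Uniform_isPseudoMetric.Build R (scaled t T)
  sball_center sball_sym sball_triangle sentourageE.

Let sdist (x y : scaled t T) : R := t%:num * mdist (x : T) y.

Let sdist_ge0 x y : 0 <= sdist x y.
Proof. by rewrite mulr_ge0// mdist_ge0. Qed.

Let sdist_positivity x y : sdist x y = 0 -> x = y.
Proof.
by move/eqP; rewrite mulf_eq0 gt_eqF//= => /eqP; exact: mdist_positivity.
Qed.

Let sballE x (e : R) : ball x e = [set y | sdist x y < e].
Proof.
rewrite -[LHS]/(ball (x : T) (e / t%:num)) ballEmdist.
by apply/seteqP; split => y /=; rewrite ltr_pdivlMr// mulrC.
Qed.

HB.instance Definition _ := PseudoMetric_isMetric.Build R (scaled t T)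
  sdist_ge0 sdist_positivity sballE.

Lemma scaled_mdistE (x y : scaled t T) :
  mdist x y = t%:num * mdist (x : T) (y : T).
Proof. by []. Qed.

End Scaled.

Definition mm_scale (R : realType) (t : {posnum R}) (X : mmspace R) :
    mmspace R :=
  @MMSpace R (scaled t X) (mm_measure X) (mm_separable X) (mm_full_support X).

(* Sets of mm-isomorphism classes are represented by predicates on mm-spaces.
   A pyramid is automatically invariant under mm-isomorphism, by the first
   closure condition. *)
Section Pyramid.
Context {R : realType}.
Implicit Types P : set (mmspace R).

Definition box_closed P := forall X,
  (forall e : R, 0 < e -> exists2 Y, P Y & (box Y X < e%:E)%E) -> P X.

Definition pyramid P :=
  [/\ P !=set0,
      box_closed P,
      forall X Y, P X -> lipschitz_order Y X -> P Y &
      forall X X', P X -> P X' ->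
        exists Y, [/\ P Y, lipschitz_order X Y & lipschitz_order X' Y]].

Definition pyr_scale (t : {posnum R}) P : set (mmspace R) :=
  [set Y | exists2 X, P X & mm_isomorphic Y (mm_scale t X)].

Definition pyr_obs_diam P (kappa : R) : \bar R :=
  lim (ereal_sup [set obs_diam X (kappa + delta) | X in P]
       @[delta --> 0^'+]).

Definition pyr_sep P (N : nat) (kappa : 'I_N.+1 -> R) : \bar R :=
  lim (ereal_sup [set sep X (fun i => kappa i - delta) | X in P]
       @[delta --> 0^'+]).

Definition levy_family (Q : nat -> set (mmspace R)) :=
  forall kappa : 'I_2 -> R, (forall i, 0 < kappa i) -> \sum_i kappa i < 1 ->
    pyr_sep (Q n) kappa @[n --> \oo] --> (0%E : \bar R).

Definition infty_dissipates (Q : nat -> set (mmspace R)) :=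
  forall (N : nat) (kappa : 'I_N.+1 -> R), (1 <= N)%N ->
    (forall i, 0 < kappa i) -> \sum_i kappa i < 1 ->
    pyr_sep (Q n) kappa @[n --> \oo] --> (+oo%E : \bar R).

Definition critical_scale_order (P : nat -> set (mmspace R))
    (c : nat -> {posnum R}) :=
  forall t : nat -> {posnum R},
    ((t n)%:num / (c n)%:num @[n --> \oo] --> (0 : R) ->
      levy_family (fun n => pyr_scale (t n) (P n))) /\
    ((t n)%:num / (c n)%:num @[n --> \oo] --> +oo ->
      infty_dissipates (fun n => pyr_scale (t n) (P n))).

Definition phase_transition_property (P : nat -> set (mmspace R)) :=
  exists c, critical_scale_order P c.

(* a ~ b for sequences in [0, +oo]. The quotients are those of \bar R, where
   x / 0 = +oo for x > 0 and +oo / x = +oo for real x > 0, so neither a zero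
   nor an infinite value can be comparable to a positive real. As usual for an
   asymptotic relation the bound is required for large n only: finitely many
   terms of the sequences do not matter. *)
Definition asymp_equiv (a b : nat -> \bar R) := exists C : R,
  \forall n \near \oo, (a n / b n <= C%:E)%E /\ (b n / a n <= C%:E)%E.

End Pyramid.

(* Main.v *)
(* Everything rests on comparing the observable diameter with separation
   distances. For an mm-space X:
   - ObsDiam(X; -k) <= Sep(X; k/2, k/2), by cutting off the two tails of the
     distribution of a 1-Lipschitz function;
   - Sep(X; k_0, ..., k_N) <= N ObsDiam(X; -k) as soon as k < sum_(j != i) k_j
     for every i: if the A_j are D-separated, then j D / N on A_j is 1-Lipschitz
     and extends to X, and a set of diameter < D / N sees only one of the A_j;
     letting N grow, every k < 1 is reached with sum_j k_j < 1;
   - ObsDiam(X; -(1 - eta)) <= Sep(X; k_0, ..., k_N) for small eta: if f is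
     1-Lipschitz and intervals of length L have f-mass < eta, then cutting at
     quantiles of f gives N + 1 sets at distance L, at a cost of 2 eta each.
   All three pass to pyramids, and Sep is homogeneous under scaling. *)

Require Import Defs.
From HB Require Import structures.
From mathcomp Require Import all_boot all_order all_algebra.
From mathcomp Require Import all_classical all_reals all_analysis.
From mathcomp Require Import lra.

Set Implicit Arguments.
Unset Strict Implicit.
Unset Printing Implicit Defensive.

Import Order.TTheory GRing.Theory Num.Theory.
Import numFieldTopology.Exports.

Local Open Scope classical_set_scope.
Local Open Scope ring_scope.

(** * Borel preimages under Lipschitz maps *)

Section Borel.
Context {R : realType}.

Lemma lipschitz_preimage_open (S T : metricType R) (k : R) (f : S -> T) :
  0 < k -> (forall x y, mdist (f x) (f y) <= k * mdist x y) ->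
  forall U, open U -> open (f @^-1` U).
Proof.
move=> k0 fk U; rewrite !openE => oU x /oU; rewrite /interior.
move=> /nbhs_ballP[e /= e0 eU].
apply/nbhs_ballP; exists (e / k); first by rewrite /= divr_gt0.
move=> y; rewrite ballEmdist /= ltr_pdivlMr// => xy.
apply: eU; rewrite ballEmdist /=; apply: le_lt_trans (fk x y) _.
by rewrite mulrC.
Qed.

(** The sets with Borel preimage form a sigma-algebra containing the open sets. The constant [k] is
    arbitrary so that maps changing the scale are covered. *)
Lemma lipschitz_preimage_borel (S T : metricType R) (k : R) (f : S -> T) :
  0 < k -> (forall x y, mdist (f x) (f y) <= k * mdist x y) ->
  forall A, <<s open >> A -> <<s open >> (f @^-1` A).
Proof.
move=> k0 fk A.
have [s0 sD sU] := smallest_sigma_algebra [set: S] (@open S).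
apply: (@smallest_sub _ _ _ [set A | <<s open >> (f @^-1` A)]); last first.
  move=> U oU; apply: sub_gen_smallest.
  exact: (lipschitz_preimage_open k0 fk).
split => /=.
- by rewrite preimage_set0.
- by move=> B BS; exact: sD BS.
- by move=> F FS; rewrite preimage_bigcup; exact: sU.
Qed.

End Borel.

(** * Masses and quantiles of 1-Lipschitz functions *)

Section Observables.
Context {R : realType} (X : mmspace R).
Implicit Types (f : X -> R^o) (A B : set (borel X)).

Let mu := mm_measure X.

Lemma observable_preimage f (A : set R^o) : one_lipschitz f -> <<s open >> A ->
  measurable (f @^-1` A : set (borel X)).
Proof.
move=> lf; apply: (@lipschitz_preimage_borel R X R^o 1 f) => //.
by move=> x y; rewrite mul1r.
Qed.

Lemma measurable_observable_gt f (a : R) : one_lipschitz f ->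
  measurable ([set z | a < f z] : set (borel X)).
Proof.
move=> lf; apply: (@observable_preimage f [set y | a < y]) => //.
by apply: sub_gen_smallest; exact: open_gt.
Qed.

Lemma measurable_observable_le f (a : R) : one_lipschitz f ->
  measurable ([set z | f z <= a] : set (borel X)).
Proof.
move=> lf; rewrite (_ : [set z | f z <= a] = ~` [set z | a < f z]).
  by apply: measurableC; exact: measurable_observable_gt.
by apply/seteqP; split=> z /=; rewrite leNgt => /negP.
Qed.

Lemma one_lipschitz_opp f :
  one_lipschitz f -> one_lipschitz (fun x => - f x : R^o).
Proof.
by move=> lf x y; apply: le_trans (lf x y); rewrite /mdist/= -opprD normrN.
Qed.

Definition mass (A : set X) : R := fine (mu A).

Lemma massE A : measurable A -> mu A = (mass A)%:E.
Proof. by move=> mA; rewrite fineK// fin_num_measure. Qed.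

Lemma mass_le A B : measurable A -> measurable B -> A `<=` B ->
  mass A <= mass B.
Proof. by move=> mA mB AB; rewrite -lee_fin -!massE// le_measure// inE. Qed.

Lemma massU_le A B : measurable A -> measurable B ->
  mass (A `|` B) <= mass A + mass B.
Proof.
move=> mA mB; rewrite -lee_fin EFinD -!massE//; last exact: measurableU.
exact: measureU2.
Qed.

Lemma massC A : measurable A -> mass (~` A) = 1 - mass A.
Proof.
move=> mA; apply: EFin_inj; rewrite EFinB -!massE//; last exact: measurableC.
exact: probability_setC.
Qed.

(** Continuity from below: the sets where [f z <= n] increase to the whole space, of mass 1. *)
Lemma observable_unbounded_mass f (s : R) : one_lipschitz f -> s < 1 ->
  exists x : R, s < mass [set z | f z <= x].
Proof.
move=> lf s1.
pose F (n : nat) : set (borel X) := [set z | f z <= n%:R].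
have mF n : measurable (F n) by exact: measurable_observable_le.
have FT : \bigcup_n F n = setT.
  apply/seteqP; split=> // z _; exists (Num.truncn `|f z|).+1 => //=.
  by apply: le_trans (ler_norm _) _; apply/ltW/truncnS_gt.
have := @nondecreasing_cvg_mu _ _ _ mu F mF.
rewrite FT => /(_ measurableT) H.
have {}H : mu \o F @ \oo --> mu setT.
  apply: H => m n mn; apply/subsetPset => z /= zm; apply: le_trans zm _.
  by rewrite ler_nat.
rewrite probability_setT in H.
have s1E : (s%:E < 1%:E :> \bar R)%E by rewrite lte_fin.
have := H _ (open_ereal_gt' s1E).
case=> N _ /(_ N (leqnn N)) /= h.
by exists N%:R; rewrite -lte_fin -(massE (mF N)).
Qed.

(** A point where the level [s] is reached, chosen within [L] of the infimum of such points, has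
    [x - L] below that infimum. Unbounded mass for [f] and for [- f] makes the infimum finite. *)
Lemma quantile f (s L : R) : one_lipschitz f -> 0 < s < 1 -> 0 < L ->
  exists x : R, s <= mass [set z | f z <= x] /\
    mass [set z | f z <= x - L] < s.
Proof.
move=> lf /andP[s0 s1] L0.
have mle a : measurable ([set z | f z <= a] : set (borel X)).
  exact: measurable_observable_le.
have [x0 hx0] := observable_unbounded_mass lf s1.
have [x1 hx1] : exists x : R, mass [set z | f z <= x] < s.
  have [|y hy] := @observable_unbounded_mass _ (1 - s) (one_lipschitz_opp lf).
    by rewrite ltrBlDr ltrDl.
  exists (- y - 1).
  have mN : measurable ([set z | - f z <= y] : set (borel X)).
    by apply: (measurable_observable_le _ (one_lipschitz_opp lf)).
  have : mass [set z | f z <= - y - 1] <= mass (~` [set z | - f z <= y]).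
    apply: mass_le => //; first exact: measurableC.
    by move=> z /= h; apply/negP; rewrite -ltNge; lra.
  by rewrite massC// => h; lra.
pose S := [set x : R | s <= mass [set z | f z <= x]].
have hS : has_inf S.
  split; first by exists x0; exact: ltW.
  exists x1 => y Sy; rewrite leNgt; apply/negP => yx1.
  have : mass [set z | f z <= y] <= mass [set z | f z <= x1].
    by apply: mass_le => // z /= h; apply: le_trans h (ltW yx1).
  by move=> h; have := le_lt_trans (le_trans Sy h) hx1; rewrite ltxx.
have [x Sx xL] := inf_adherent L0 hS.
exists x; split => //; rewrite ltNge; apply/negP => h.
by have := ge_inf hS.2 h; lra.
Qed.

End Observables.

(** * Separated families and the separation distance *)

Section Separation.
Context {R : realType} (X : mmspace R) (N : nat).
Implicit Types (kappa : 'I_N.+1 -> R) (A : 'I_N.+1 -> set (borel X)) (D : R).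
Local Open Scope ereal_scope.

(** Infima of distances become a pointwise bound, and measures become real masses; [sep] is the
    supremum of the [D] with a witness, truncated below at 0. *)
Definition sep_witness kappa A D := [/\ (forall i, measurable (A i)),
  (forall i, (kappa i <= mass (A i))%R) &
  forall i j, i != j -> forall x y, A i x -> A j y ->
    (D <= mdist (x : X) (y : X))%R].

Lemma sep_ge0 kappa : 0 <= sep X kappa.
Proof. by rewrite le_max lexx. Qed.

Lemma sep_witness_le kappa A D : sep_witness kappa A D -> D%:E <= sep X kappa.
Proof.
move=> [mA kA dA]; rewrite le_max; apply/orP; right.
apply: le_ereal_sup_tmp.
exists (\big[mine/+oo]_(p : 'I_N.+1 * 'I_N.+1 | p.1 != p.2)
           set_dist (A p.1 : set X) (A p.2 : set X)).
  exists A => //= i; split; first exact: mA.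
  by rewrite -/(mm_measure X _) (massE (mA i)) lee_fin.
apply/bigmin_geP; split => [|[i j] /= ij]; first exact: leey.
by apply: le_ereal_inf_tmp => _ [x Ax [y Ay <-]]; rewrite lee_fin (dA i j).
Qed.

Lemma sep_le kappa (M : \bar R) : 0 <= M ->
  (forall A D, (0 < D)%R -> sep_witness kappa A D -> D%:E <= M) ->
  sep X kappa <= M.
Proof.
move=> M0 H; rewrite ge_max M0 /=; apply: ge_ereal_sup => _ [A /= AP <-].
(* The minimum may be [+oo], for instance for two sets one of which is empty, so the real numbers
   [D] below [v] are tested instead of [v]. *)
set v := (X in X <= M).
have vE D : D%:E <= v -> D%:E <= M.
  move=> Dv; have [D0|D0] := leP D (0 : R)%R.
    by apply: le_trans M0; rewrite lee_fin.
  apply: (H A D D0); split => [i|i|i j ij x y Ax Ay].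
  - by have [] := AP i.
  - by have [mA] := AP i; rewrite (massE mA) lee_fin.
  - have /bigmin_geP[_ /(_ (i, j) ij)] := Dv.
    rewrite -lee_fin => /le_trans; apply; apply: ereal_inf_lbound.
    by exists x => //; exists y.
clearbody v; case: v vE => [r vE|vE|_]; first by apply: vE.
  by rewrite leye_eq; apply/eqP/eqyP => D _; apply: vE; rewrite leey.
exact: leNye.
Qed.

Lemma sep_mono kappa kappa' : (forall i, (kappa' i <= kappa i)%R) ->
  sep X kappa <= sep X kappa'.
Proof.
move=> kk; apply: sep_le => [|A D _ [mA kA dA]]; first exact: sep_ge0.
by apply: sep_witness_le; split => // i; apply: le_trans (kk i) (kA i).
Qed.

End Separation.

(** * Diameters and observable diameters *)

Section Diameter.
Context {R : realType} (X : mmspace R).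
Local Open Scope ereal_scope.

Lemma diam_ge (T : metricType R) (A : set T) x y :
  A x -> A y -> (mdist x y)%:E <= diam A.
Proof.
move=> Ax Ay; rewrite le_max; apply/orP; right.
by apply: ereal_sup_ubound; exists x => //; exists y.
Qed.

Lemma diam_le (T : metricType R) (A : set T) (M : \bar R) : 0 <= M ->
  (forall x y, A x -> A y -> (mdist x y)%:E <= M) -> diam A <= M.
Proof.
move=> M0 H; rewrite ge_max M0 /=.
by apply: ge_ereal_sup => _ [x Ax [y Ay <-]]; exact: H.
Qed.

Lemma obs_diam_ge0 kappa : 0 <= obs_diam X kappa.
Proof.
apply: le_ereal_sup_tmp; eexists.
  exists (fun=> 0%R : R^o) => //; move=> x y /=.
  by rewrite mdistxx mdist_ge0.
by apply: le_ereal_inf_tmp => _ [A _ <-]; rewrite le_max lexx.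
Qed.

Lemma obs_diam_mono (kappa kappa' : R) : (kappa <= kappa')%R ->
  obs_diam X kappa' <= obs_diam X kappa.
Proof.
move=> kk; apply: ge_ereal_sup => _ [f /= lf <-].
apply: le_ereal_sup_tmp; eexists; first by exists f.
apply: ereal_inf_le_tmp => _ [A /= [mA kA] <-]; exists A => //; split => //.
by apply: le_trans kA; rewrite lee_fin lerD2l lerN2.
Qed.

End Diameter.

(** * A 1-Lipschitz function with prescribed values on separated sets *)

Section McShane.
Context {R : realType} (T : metricType R) (N : nat).
Context (A : 'I_N.+1 -> set T) (c : R).
Hypothesis A0 : A ord0 !=set0.
Hypothesis c0 : 0 <= c.
Hypothesis dA : forall i j, i != j -> forall x y, A i x -> A j y ->
  N%:R * c <= mdist x y.

Let S (x : T) : set R :=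
  [set v | exists j y, A j y /\ v = j%:R * c + mdist x y].

(* McShane's extension of the function with value [j * c] on [A j]. *)
Definition ladder (x : T) : R^o := inf (S x).

Let hS x : has_inf (S x).
Proof.
split; first by have [y Ay] := A0; eexists; exists ord0, y.
by exists 0 => _ [j [y [_ ->]]]; rewrite addr_ge0 ?mulr_ge0 ?mdist_ge0.
Qed.

Let ladder_le x y : ladder x <= ladder y + mdist x y.
Proof.
rewrite -lerBlDr; apply: lb_le_inf; first exact: (hS y).1.
move=> _ [j [z [Az ->]]]; rewrite lerBlDr.
apply: (@le_trans _ _ (j%:R * c + mdist x z)).
  by apply: (ge_inf (hS x).2); exists j, z.
by rewrite -addrA lerD2l addrC; exact: metric_triangle.
Qed.

Lemma ladder_lipschitz : one_lipschitz ladder.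
Proof.
move=> x y; change (`|(ladder y : R) - (ladder x : R)| <= mdist x y).
have := ladder_le x y; have := ladder_le y x; rewrite (metric_sym y x) => h1 h2.
by rewrite ler_norml; apply/andP; split; lra.
Qed.

(** The choice [y = x] attains [i * c]; candidates from another [A j] are at least [N * c >= i * c]
    by separation. *)
Lemma ladderE i x : A i x -> ladder x = i%:R * c.
Proof.
move=> Ax; apply/eqP; rewrite eq_le; apply/andP; split.
  by apply: (ge_inf (hS x).2); exists i, x; rewrite mdistxx addr0.
apply: lb_le_inf; first exact: (hS x).1.
move=> _ [j [y [Ay ->]]].
have [->|ij] := eqVneq i j; first by rewrite lerDl mdist_ge0.
apply: (@le_trans _ _ (N%:R * c)).
  by rewrite ler_wpM2r// ler_nat -ltnS.
by apply: le_trans (dA ij Ax Ay) _; rewrite lerDr mulr_ge0.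
Qed.

End McShane.

(** * Observable diameter against separation distance *)

Section Comparison.
Context {R : realType} (X : mmspace R).

Lemma massD_ge (A B : set (borel X)) : measurable A -> measurable B ->
  mass A - mass B <= mass (A `\` B).
Proof.
move=> mA mB; rewrite lerBlDr.
have mD : measurable (A `\` B) by exact: measurableD.
apply: le_trans (massU_le mD mB); apply: mass_le => //.
  exact: measurableU.
by move=> z Az; have [Bz|nBz] := pselect (B z); [right|left].
Qed.

Lemma mass_bigU (N : nat) (P : {pred 'I_N}) (A : 'I_N -> set (borel X)) :
  (forall i, measurable (A i)) -> trivIset setT A ->
  mass (\big[setU/set0]_(i < N | P i) A i) = \sum_(i < N | P i) mass (A i).
Proof.
move=> mA tA; apply: EFin_inj.
rewrite -massE; last by apply: bigsetU_measurable.
rewrite measure_bigsetU_ord// -sumEFin; apply: eq_bigr => i _; exact: massE.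
Qed.

Lemma mass_gt0 (A : set X) : 0 < mass A -> A !=set0.
Proof.
by apply: contraPP => /set0P/negP/negPn/eqP ->; rewrite /mass measure0 ltxx.
Qed.

Lemma sep_le_obs_diam (N : nat) (kappa : 'I_N.+1 -> R) (k : R) : (0 < N)%N ->
  (forall i, 0 < kappa i) -> (forall i, k < \sum_(j | j != i) kappa j) ->
  (sep X kappa <= N%:R%:E * obs_diam X k)%E.
Proof.
move=> N0 kappa0 kP.
have Npos : 0 < N%:R :> R by rewrite ltr0n.
apply: sep_le; first by rewrite mule_ge0 ?obs_diam_ge0 ?lee_fin.
move=> A D D0 [mA kA dA].
(* The [N + 1] values spaced by [D / N] span exactly [D], the distance available between any two of
   the sets. *)
rewrite -lee_pdivrMl// -EFinM; set c := N%:R^-1 * D.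
have c0 : 0 < c by rewrite mulr_gt0 ?invr_gt0.
have A0 : A ord0 !=set0 by apply: mass_gt0; apply: lt_le_trans (kA _).
have NcD : N%:R * c = D by rewrite mulrA divff ?mul1r// gt_eqF.
have dA' i j : i != j -> forall x y, A i x -> A j y ->
    N%:R * c <= mdist (x : X) (y : X) by rewrite NcD; exact: dA.
pose f := @ladder R X N A c.
have lf : one_lipschitz f by apply: ladder_lipschitz => //; exact: ltW.
have fE i x : A i x -> f x = i%:R * c by apply: ladderE => //; exact: ltW.
apply: le_ereal_sup_tmp; eexists; first by exists f.
apply: le_ereal_inf_tmp => _ [B /= [mB kB] <-].
rewrite leNgt; apply/negP => Bc.
(* Distinct values [j * c] are at least [c] apart and [diam B < c], so [B] contains at most one of
   them; if none, any index serves. *)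
have [i iP] : exists i : 'I_N.+1, forall j, j != i -> ~ B (j%:R * c).
  have [[i Bi]|nB] := pselect (exists i : 'I_N.+1, B (i%:R * c)); last first.
    by exists ord0 => j _ Bj; apply: nB; exists j.
  exists i => j ji Bj; have := le_lt_trans (diam_ge Bj Bi) Bc.
  rewrite lte_fin ltNge => /negP; apply.
  rewrite /mdist /= -mulrBl normrM (gtr0_norm c0) ler_peMl ?(ltW c0)//.
  have [ij|ij|/val_inj ij] := ltngtP i j.
  - by rewrite distrC -natrB ?(ltnW ij)// normr_nat ler1n subn_gt0.
  - by rewrite -natrB ?(ltnW ij)// normr_nat ler1n subn_gt0.
  - by rewrite ij eqxx in ji.
have tA : trivIset setT A.
  move=> j1 j2 _ _ [x [x1 x2]]; apply/eqP; apply: contraT => j12.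
  by have := dA _ _ j12 _ _ x1 x2; rewrite mdistxx leNgt D0.
(* The preimage of [B] avoids [U], whose mass exceeds [k], so its mass cannot reach [1 - k]. *)
set U := \big[setU/set0]_(j < N.+1 | j != i) A j.
have mU : measurable U by apply: bigsetU_measurable.
have kU : k < mass U.
  by rewrite mass_bigU//; apply: lt_le_trans (kP i) _; apply: ler_sum.
have mfB : measurable (f @^-1` B : set (borel X)) by exact: observable_preimage.
have BU : mass (f @^-1` B) <= mass (~` U).
  apply: mass_le => //; first exact: measurableC.
  move=> z /= Bz; rewrite /U -bigcup_seq_cond => -[j /= /andP[_ ji] Az].
  by apply: (iP _ ji); rewrite -(fE _ _ Az).
rewrite /pushforward (massE mfB) lee_fin in kB.
by rewrite massC// in BU; lra.
Qed.

Lemma obs_diam_le_sep (k : R) : 0 < k < 1 ->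
  (obs_diam X k <= sep X (fun _ : 'I_2 => (k / 2)%R))%E.
Proof.
move=> /andP[k0 k1]; apply: ge_ereal_sup => _ [f /= lf <-].
apply/lee_addgt0Pr => e e0.
have lNf := one_lipschitz_opp lf.
have k2 : 0 < k / 2 < 1 by apply/andP; split; lra.
have e2 : 0 < e / 2 by lra.
have [a [ka ak]] := quantile lf k2 e2.
have [b [kb bk]] := quantile lNf k2 e2.
(* The two tails are [f <= a] and [f >= - b]; if they overlap, then [- b - a <= 0]. *)
have Dsep : ((- b - a)%:E <= sep X (fun _ : 'I_2 => (k / 2)%R))%E.
  apply: (@sep_witness_le _ _ _ _ (fun i => if i == ord0 then [set z | f z <= a]
    else [set z | - f z <= b])); split => [i|i|i j].
  - by case: ifP => _; exact: measurable_observable_le.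
  - by case: ifP.
  - have d x y : - b - a <= `|f y - f x| -> - b - a <= mdist x y.
      by move=> /le_trans; apply; exact: lf.
    case: ifPn => [/eqP ->|i0]; case: ifPn => [/eqP ->//|j0] ij x y /= hx hy.
    + by apply: d; apply: le_trans (ler_norm _); lra.
    + by apply: d; rewrite distrC; apply: le_trans (ler_norm _); lra.
    + by move: i0 j0 ij; case: i => -[|[]]//; case: j => -[|[]].
(* Widening by [e / 2] on each side moves the cuts to points where each removed tail has mass below
   [k / 2]. *)
pose B := [set y : R^o | a - e / 2 < y] `&` [set y | y < - b + e / 2].
have oB : open B by apply: openI; [exact: open_gt|exact: open_lt].
have mB : <<s open >> B by exact: sub_gen_smallest.
have mfB : measurable (f @^-1` B : set (borel X)) by exact: observable_preimage.
have kB : 1 - k <= mass (f @^-1` B).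
  have mCa : measurable ([set z | f z <= a - e / 2] : set (borel X)).
    exact: measurable_observable_le.
  have mCb : measurable ([set z | - f z <= b - e / 2] : set (borel X)).
    exact: (measurable_observable_le _ lNf).
  have : mass (~` (f @^-1` B)) <=
      mass ([set z | f z <= a - e / 2] `|` [set z | - f z <= b - e / 2]).
    apply: mass_le; [exact: measurableC|exact: measurableU|].
    move=> z /= nB; have [h|h] := leP (f z) (a - e / 2); first by left.
    right; rewrite leNgt; apply/negP => h'; apply: nB; split => //=.
    by lra.
  rewrite massC// => h1; have := massU_le mCa mCb => h2.
  have h3 := le_trans h1 h2.
  by lra.
(* A point of [B] shows that [(- b - a) + e] is positive, as a bound on a diameter must be
   nonnegative. *)
have [z [/= za zb]] : f @^-1` B !=set0 by apply: mass_gt0; lra.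
apply: (@le_trans _ _ (diam B)).
  apply: ereal_inf_lbound; exists B => //; split => //.
  by rewrite /pushforward (massE mfB) lee_fin.
apply: (@le_trans _ _ ((- b - a) + e)%:E); last by rewrite EFinD leeD2r.
apply: diam_le; first by rewrite lee_fin; lra.
move=> x y [/= xa xb] [/= ya yb]; rewrite lee_fin /mdist /= ler_norml.
by apply/andP; split; lra.
Qed.

End Comparison.

(** * Many separated sets from a function with small mass on short intervals *)

Section Dissipation.
Context {R : realType} (X : mmspace R).

(** The level is [1 - (1 - eta) = eta], and []a, a + L]] has diameter at most [L]; mass [eta] on it
    would bound the partial diameter by [L]. *)
Lemma obs_diam_gt_lt_mass (eta L : R) : 0 < L ->
  (L%:E < obs_diam X (1 - eta))%E ->
  exists2 f : X -> R^o, one_lipschitz f &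
    forall a, mass [set z | f z <= a + L] < mass [set z | f z <= a] + eta.
Proof.
move=> L0 /ereal_sup_gt [_ [f /= lf <-] Lf]; exists f => // a.
rewrite ltNge; apply/negP => le_eta.
pose B : set R^o := [set y | a < y <= a + L].
have mB : <<s open >> B.
  have -> : B = [set y | a < y] `\` [set y | a + L < y].
    apply/seteqP; split => y /=; first move=> /andP[ay h].
      by split=> //; apply/negP; rewrite -leNgt.
    by move=> [ay /negP]; rewrite -leNgt => h; apply/andP.
  apply: (@measurableD _ (borel R^o));
    by apply: sub_gen_smallest; exact: open_gt.
have mfB : measurable (f @^-1` B : set (borel X)) by exact: observable_preimage.
have mle b : measurable ([set z | f z <= b] : set (borel X)).
  exact: measurable_observable_le.
have etaB : eta <= mass (f @^-1` B).
  have : mass [set z | f z <= a + L] <=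
      mass ([set z | f z <= a] `|` f @^-1` B).
    apply: mass_le => //; first exact: measurableU.
    by move=> z /= zL; have [za|za] := leP (f z) a; [left|right; apply/andP].
  have := massU_le (mle a) mfB => h1 h2; have h3 := le_trans h2 h1; lra.
move: Lf; rewrite ltNge => /negP; apply.
apply: (@le_trans _ _ (diam B)).
  apply: ereal_inf_lbound; exists B => //; split => //.
  by rewrite /pushforward (massE mfB) lee_fin; lra.
apply: diam_le; first by rewrite lee_fin ltW.
move=> x y /= /andP[xa xb] /andP[ya yb]; rewrite lee_fin /mdist /= ler_norml.
by apply/andP; split; lra.
Qed.

Lemma obs_diam_gt_le_sep (N : nat) (kappa : 'I_N.+1 -> R) (eta L : R) :
  0 < L -> 0 < eta -> (forall i, 0 < kappa i) ->
  \sum_i kappa i + 2 * N.+1%:R * eta < 1 ->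
  (L%:E < obs_diam X (1 - eta) -> L%:E <= sep X kappa)%E.
Proof.
move=> L0 eta0 kappa0 kappa1 /(obs_diam_gt_lt_mass L0) [f lf].
pose F a := mass [set z | f z <= a]; rewrite -/(F _) => FL.
have {}FL a : F (a + L) < F a + eta by exact: FL.
have mle b : measurable ([set z | f z <= b] : set (borel X)).
  exact: measurable_observable_le.
pose kn (j : nat) := kappa (inord j).
have kn0 j : 0 < kn j by exact: kappa0.
(* Target level for the cut [x i]: the masses wanted up to index [i], plus [2 * eta] per cut, one
   [eta] for overshooting the level and one for the discarded gap of length [L]. *)
pose s (i : nat) := \sum_(j < i.+1) kn j + 2 * i.+1%:R * eta.
have sS i : s i.+1 = s i + kn i.+1 + 2 * eta.
  have iE : i.+2%:R = i.+1%:R + 1 :> R by rewrite natr1.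
  by rewrite /s big_ord_recr /= iE; lra.
have s0 : s 0%N = kn 0%N + 2 * eta by rewrite /s big_ord1 mulr1.
have s_lt i j : (i < j)%N -> s i + 2 * eta <= s j.
  elim: j => // j IH; rewrite ltnS leq_eqVlt => /orP[/eqP ->|/IH h].
    by rewrite sS; have := kn0 j.+1; lra.
  by rewrite sS; have := kn0 j.+1; lra.
have s_gt0 i : 0 < s i.
  case: i => [|i]; first by rewrite s0; have := kn0 0%N; lra.
  by have := s_lt 0%N i.+1 isT; rewrite s0; have := kn0 0%N; lra.
have sN : s N < 1.
  rewrite /s (eq_bigr kappa) // => i _; rewrite /kn; congr kappa.
  exact: inord_val.
have s_lt1 i : (i <= N)%N -> s i < 1.
  rewrite leq_eqVlt => /orP[/eqP -> //|/s_lt]; lra.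
(* The mass at [x - L] is below [s i], and an interval of length [L] adds less than [eta]; this
   bounds the overshoot. *)
have /choice[x xP] : forall i : nat, exists x : R, (i <= N)%N ->
    s i <= F x /\ F x < s i + eta.
  move=> i; have [iN|] := leqP i N; last by exists 0.
  have s01 : 0 < s i < 1 by rewrite s_gt0 s_lt1.
  have [x [sx xs]] := quantile lf s01 L0.
  exists x => _; split=> //; have := FL (x - L); rewrite subrK => h.
  by apply: lt_trans h _; rewrite ltrD2r.
(* The slab [x (i - 1) + L < f <= x i], with no lower cut for [i = 0]. *)
pose A (i : 'I_N.+1) : set (borel X) := [set z | f z <= x i] `\`
  (if i : nat is j.+1 then [set z | f z <= x j + L] else set0).
(* Levels differ by at least [2 * eta] while overshoots stay below [eta], so the cuts are
   ordered. *)
have x_le i j : (i <= j)%N -> (j <= N)%N -> x i <= x j.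
  rewrite leq_eqVlt => /orP[/eqP -> //|ij] jN.
  rewrite leNgt; apply/negP => xij.
  have : F (x j) <= F (x i).
    by apply: mass_le => // z /= h; apply: le_trans h (ltW xij).
  have [_ h1] := xP i (leq_trans (ltnW ij) jN).
  have [h2 _] := xP j jN.
  have h3 := s_lt _ _ ij => h4.
  by have := le_lt_trans (le_trans h2 h4) h1; lra.
apply: (@sep_witness_le _ _ _ _ A); split => [i|i|].
- by apply: measurableD => //; case: (i : nat).
- have -> : kappa i = kn i by rewrite /kn inord_val.
  have iN : (i <= N)%N by rewrite -ltnS.
  (* For [i = j + 1], the removed part has mass below [s j + 2 * eta], which is [s i - kn i]. *)
  have [h1 _] := xP i iN; rewrite /A.
  apply: le_trans (massD_ge _ _) => //; last by case: (i : nat).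
  rewrite -/(F _); case: (i : nat) iN h1 => [|j] jN h1.
    by rewrite /mass measure0 /=; move: h1; rewrite s0; lra.
  rewrite -/(F _); have [_ h2] := xP j (ltnW jN).
  by have := FL (x j); move: h1; rewrite sS; lra.
have dA (i j : 'I_N.+1) : (i < j)%N -> forall y z, A i y -> A j z ->
    L <= mdist (y : X) (z : X).
  move=> ij y z [/= yi _]; rewrite /A.
  have jN : (j <= N)%N by rewrite -ltnS.
  case: (j : nat) ij jN => // j' ij jN [/= _ /negP]; rewrite -ltNge => zj.
  have xij := x_le i j' ij (ltnW jN).
  apply: le_trans (lf y z); apply: le_trans (ler_norm _); lra.
move=> i j ij y z yi zj; have [lij|lji|/val_inj eij] := ltngtP i j.
- exact: (dA i j).
- by rewrite metric_sym; exact: (dA j i).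
- by rewrite eij eqxx in ij.
Qed.

End Dissipation.

(** * Separation distance under rescaling *)

Section Scaling.
Context {R : realType}.

(** [D]-separated sets of [Y] pull back to sets of the same mass that are [D / t]-separated. *)
Lemma sep_transfer (N : nat) (kappa : 'I_N.+1 -> R) (X Y : mmspace R) (t : R)
    (g : X -> Y) : 0 < t -> (forall x y, mdist (g x) (g y) <= t * mdist x y) ->
  (forall A : set (borel Y), measurable A ->
    mm_measure X (g @^-1` A) = mm_measure Y A) ->
  (sep Y kappa <= t%:E * sep X kappa)%E.
Proof.
move=> t0 gt gmu; apply: sep_le.
  by rewrite mule_ge0 ?sep_ge0 ?lee_fin ?ltW.
move=> A D D0 [mA kA dA]; rewrite -lee_pdivrMl// -EFinM.
apply: (@sep_witness_le _ _ _ _ (fun i => g @^-1` A i)).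
split => [i|i|i j ij x y Ax Ay].
- exact: (lipschitz_preimage_borel t0 gt (mA i)).
- by apply: le_trans (kA i) _; rewrite /mass gmu.
- by rewrite ler_pdivrMl//; apply: le_trans (gt x y); exact: (dA i j).
Qed.

Lemma mm_isomorphic_refl (X : mmspace R) : mm_isomorphic X X.
Proof. by exists id; split; [exists id|move=> x y|move=> A mA]. Qed.

Lemma mm_scale_pyr_scale (t : {posnum R}) (P : set (mmspace R)) X :
  P X -> pyr_scale t P (mm_scale t X).
Proof. by move=> PX; exists X => //; exact: mm_isomorphic_refl. Qed.

Lemma sep_scale_le (N : nat) (kappa : 'I_N.+1 -> R) (t : {posnum R})
    (X Y : mmspace R) : mm_isomorphic Y (mm_scale t X) ->
  (sep Y kappa <= t%:num%:E * sep X kappa)%E.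
Proof.
move=> [f [[g fK gK] fd fmu]].
have gd (x y : mm_scale t X) : mdist (g x) (g y) = mdist x y.
  by rewrite -fd !gK.
(* The inverse isometry, read as a map from the unscaled [X], multiplies distances by [t]. *)
apply: (@sep_transfer _ _ X Y t%:num g) => //; first by move=> x y; rewrite gd.
move=> A mA.
have mgA : measurable (g @^-1` A : set (borel (mm_scale t X))).
  apply: (@lipschitz_preimage_borel R (mm_scale t X) Y 1 g) => //.
  by move=> x y; rewrite gd mul1r.
have := fmu _ mgA; rewrite /pushforward /= => <-; congr (mm_measure Y _).
by apply/seteqP; split => x /=; rewrite fK.
Qed.

Lemma sep_scale_ge (N : nat) (kappa : 'I_N.+1 -> R) (t : {posnum R})
    (X : mmspace R) :
  (t%:num%:E * sep X kappa <= sep (mm_scale t X) kappa)%E.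
Proof.
rewrite -lee_pdivlMl//.
apply: (@sep_transfer _ _ (mm_scale t X) X _ (id : mm_scale t X -> X)) => //.
by move=> x y; rewrite scaled_mdistE mulrA mulVf// mul1r.
Qed.

End Scaling.

(** * Passage from mm-spaces to pyramids *)

Section PyramidInvariants.
Context {R : realType}.
Implicit Type P : set (mmspace R).
Local Open Scope ereal_scope.

(** A larger [delta] weakens the mass constraints, so the inner supremum is nondecreasing in [delta]
    and its right limit is an infimum. For the observable diameter the monotonicity is reversed. *)
Lemma pyr_sepE P (N : nat) (kappa : 'I_N.+1 -> R) :
  pyr_sep P kappa =
  ereal_inf [set ereal_sup [set sep X (fun i => kappa i - delta)%R | X in P]
            | delta in `]0%R, +oo[ ].
Proof.
apply/cvg_lim => //; apply: nondecreasing_at_right_cvge => // d d' _ _ dd'.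
apply: ge_ereal_sup => _ [X PX <-]; apply: le_ereal_sup_tmp.
eexists; first by exists X.
by apply: sep_mono => i; rewrite lerD2l lerN2.
Qed.

Lemma pyr_obs_diamE P (kappa : R) :
  pyr_obs_diam P kappa =
  ereal_sup [set ereal_sup [set obs_diam X (kappa + delta)%R | X in P]
            | delta in `]0%R, +oo[ ].
Proof.
apply/cvg_lim => //; apply: nonincreasing_at_right_cvge => // d d' _ _ dd'.
apply: ge_ereal_sup => _ [X PX <-]; apply: le_ereal_sup_tmp.
eexists; first by exists X.
by apply: obs_diam_mono; rewrite lerD2l.
Qed.

Lemma pyr_sep_ge0 P (N : nat) (kappa : 'I_N.+1 -> R) :
  P !=set0 -> 0 <= pyr_sep P kappa.
Proof.
move=> [X PX]; rewrite pyr_sepE; apply: le_ereal_inf_tmp => _ [d _ <-].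
apply: le_ereal_sup_tmp; eexists; first by exists X.
exact: sep_ge0.
Qed.

Lemma pyr_obs_diam_ge0 P (kappa : R) : P !=set0 -> 0 <= pyr_obs_diam P kappa.
Proof.
move=> [X PX]; rewrite pyr_obs_diamE; apply: le_ereal_sup_tmp; eexists.
  by exists 1%R => //=; rewrite in_itv /= ltr01.
apply: le_ereal_sup_tmp; eexists; first by exists X.
exact: obs_diam_ge0.
Qed.

Lemma pyr_sep_scale P (N : nat) (kappa : 'I_N.+1 -> R) (t : {posnum R}) :
  pyr_sep (pyr_scale t P) kappa = t%:num%:E * pyr_sep P kappa.
Proof.
apply/eqP; rewrite eq_le; apply/andP; split.
  rewrite -lee_pdivrMl//; rewrite [leRHS]pyr_sepE.
  apply: le_ereal_inf_tmp => _ [d d0 <-]; rewrite lee_pdivrMl// pyr_sepE.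
  apply: ge_ereal_inf; eexists; first by exists d.
  apply: ge_ereal_sup => _ [Y [X PX YX] <-].
  apply: le_trans (sep_scale_le _ YX) _.
  by apply: lee_wpmul2l => //; apply: ereal_sup_ubound; exists X.
rewrite [leRHS]pyr_sepE; apply: le_ereal_inf_tmp => _ [d d0 <-].
rewrite -lee_pdivlMl// pyr_sepE.
apply: ge_ereal_inf; eexists; first by exists d.
apply: ge_ereal_sup => _ [X PX <-]; rewrite lee_pdivlMl//.
apply: le_trans (sep_scale_ge _ _ _) _; apply: ereal_sup_ubound.
by exists (mm_scale t X) => //; exact: mm_scale_pyr_scale.
Qed.

Lemma pyr_sep_le_obs_diam P (N : nat) (kappa : 'I_N.+1 -> R) (k : R) :
  (0 < N)%N -> (forall i, 0 < kappa i)%R ->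
  (forall i, k < \sum_(j | j != i) kappa j)%R ->
  pyr_sep P kappa <= N%:R%:E * pyr_obs_diam P k.
Proof.
move=> N0 kappa0 kP.
(* Room to lower every [kappa i] and raise [k] by one [d]: this needs [d < kappa i], and [N * d + d]
   below the excess of the sum of [N] terms over [k]. Halving makes both strict. *)
pose gap i := Order.min (kappa i) ((\sum_(j | j != i) kappa j - k) / N.+1%:R)%R.
pose d := (\big[Order.min/1]_i gap i / 2)%R.
have d0 : (0 < d)%R.
  rewrite divr_gt0//; apply/bigmin_gtP; split => // i _.
  by rewrite lt_min kappa0 divr_gt0// subr_gt0.
have dgap i : (d < gap i)%R.
  have : (\big[Order.min/1]_i gap i <= \big[Order.min/1]_i gap i)%R by [].
  move=> /bigmin_geP[_ /(_ i isT)]; apply: lt_le_trans.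
  by rewrite /d; move: d0; rewrite /d; lra.
rewrite pyr_sepE; apply: ge_ereal_inf; eexists.
  by exists d => //=; rewrite in_itv /= d0.
apply: ge_ereal_sup => _ [X PX <-].
apply: (@le_trans _ _ (N%:R%:E * obs_diam X (k + d))).
  apply: sep_le_obs_diam => // i; have := dgap i;
    rewrite lt_min => /andP[h1 h2].
    by rewrite subr_gt0.
  rewrite sumrB sumr_const cardC1 card_ord /=.
  move: h2; rewrite ltr_pdivlMr// -natr1 mulrDr mulr1 mulr_natr.
  by lra.
apply: lee_wpmul2l; first by rewrite lee_fin.
rewrite pyr_obs_diamE; apply: le_ereal_sup_tmp; eexists.
  by exists d => //=; rewrite in_itv /= d0.
by apply: ereal_sup_ubound; exists X.
Qed.

(** Both perturbations help: raising [k] lowers the observable diameter, and lowering [kappa] raises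
    the separation. *)
Lemma pyr_obs_diam_le_pyr_sep P (N : nat) (kappa : 'I_N.+1 -> R) (k : R) :
  (forall X, P X -> obs_diam X k <= sep X kappa) ->
  pyr_obs_diam P k <= pyr_sep P kappa.
Proof.
move=> H; rewrite pyr_obs_diamE; apply: ge_ereal_sup => _ [d /= d0 <-].
apply: ge_ereal_sup => _ [X PX <-].
rewrite pyr_sepE; apply: le_ereal_inf_tmp => _ [d' /= d'0 <-].
apply: le_ereal_sup_tmp; eexists; first by exists X.
rewrite !in_itv /= !andbT in d0 d'0.
apply: (@le_trans _ _ (obs_diam X k)).
  by apply: obs_diam_mono; rewrite lerDl ltW.
apply: le_trans (H X PX) _.
by apply: sep_mono => i; rewrite gerBl ltW.
Qed.

Lemma pyr_obs_diam_le_sep2 P (k : R) : (0 < k < 1)%R ->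
  pyr_obs_diam P k <= pyr_sep P (fun _ : 'I_2 => (k / 2)%R).
Proof.
by move=> k01; apply: pyr_obs_diam_le_pyr_sep => X _; exact: obs_diam_le_sep.
Qed.

Lemma lee_pos_approx (a b : \bar R) : 0 <= b ->
  (forall L : R, (0 < L)%R -> L%:E < a -> L%:E <= b) -> a <= b.
Proof.
case: b => [b|_ _|//]; last exact: leey.
rewrite lee_fin => b0 H; rewrite leNgt; apply/negP => ba.
have [L bL La] : exists2 L : R, (b < L)%R & L%:E < a.
  case: a ba {H} => [a|_|//]; last by exists (b + 1)%R; rewrite ?ltrDl ?ltry.
  by rewrite lte_fin => ba; exists ((a + b) / 2)%R; rewrite ?lte_fin; lra.
by have := H L (le_lt_trans b0 bL) La; rewrite lee_fin leNgt bL.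
Qed.

Lemma pyr_obs_diam_le_sep P (N : nat) (kappa : 'I_N.+1 -> R) (eta : R) :
  (0 < eta)%R -> (forall i, 0 < kappa i)%R ->
  (\sum_i kappa i + 2 * N.+1%:R * eta < 1)%R ->
  pyr_obs_diam P (1 - eta)%R <= pyr_sep P kappa.
Proof.
move=> eta0 kappa0 kappa1; apply: pyr_obs_diam_le_pyr_sep => X _.
apply: lee_pos_approx => [|L L0 LX]; first exact: sep_ge0.
exact: (obs_diam_gt_le_sep L0 eta0).
Qed.

End PyramidInvariants.

(** * Eventual bounds extracted from limits along all scalings *)

Section Asymptotics.
Context {R : realType}.

(* The proof by contradiction inverts a choice [n_ k >= k] of times at which
   [bad (n_ k) k]: the slowly growing sequence is [s n = min {k | n <= n_ k}]. *)
Lemma eventually_not_of_slow_growth (bad : nat -> nat -> Prop) :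
  (forall n k l, (k <= l)%N -> bad n l -> bad n k) ->
  (forall s : nat -> nat, s n @[n --> \oo] --> \oo ->
     \forall n \near \oo, ~ bad n (s n)) ->
  exists k, \forall n \near \oo, ~ bad n k.
Proof.
move=> bad_anti slow; apply: contrapT => nH.
have /choice[n_ n_P] : forall k, exists n, (k <= n)%N /\ bad n k.
  move=> k; apply: contrapT => nk; apply: nH.
  exists k; exists k => //= n kn bnk.
  by apply: nk; exists n.
have n_ex n : exists k, (n <= n_ k)%N by exists n; have [] := n_P n.
pose s n := ex_minn (n_ex n).
have sP n : (n <= n_ (s n))%N by rewrite /s; case: ex_minnP.
have s_le k : (s (n_ k) <= k)%N.
  by rewrite /s; case: ex_minnP => m _; apply.
have sy : s n @[n --> \oo] --> \oo.
  (* Past all [n_ k] with [k < K], the minimum defining [s n] is at least [K]. *)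
  apply/cvgnyPge => K; exists (\max_(k < K) n_ k).+1 => //= n /= maxn.
  rewrite leqNgt; apply/negP => snK.
  have := @leq_bigmax _ (fun k : 'I_K => n_ k) (Ordinal snK) => /= h.
  by have := leq_ltn_trans (leq_trans (sP n) h) maxn; rewrite ltnn.
have [N _ NP] := slow s sy.
have [Nn bN] := n_P N.
by apply: (NP (n_ N) Nn); apply: bad_anti bN.
Qed.

Lemma cvg_inv_nat (s : nat -> nat) : s n @[n --> \oo] --> \oo ->
  (s n).+1%:R^-1 @[n --> \oo] --> (0 : R).
Proof.
by move=> sy; exact: (@cvg_comp _ _ _ s harmonic _ _ _ sy cvg_harmonic).
Qed.

Lemma cvg_natS (s : nat -> nat) : s n @[n --> \oo] --> \oo ->
  ((s n).+1%:R : R) @[n --> \oo] --> +oo.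
Proof.
move=> sy; apply/cvgryPge => A.
have [K _ KP] := (cvgnyPge _).1 sy (Num.truncn `|A|).
exists K => //= n Kn; apply: le_trans (ler_norm A) _; apply: ltW.
by apply: lt_le_trans (truncnS_gt _) _; rewrite ler_nat ltnS; exact: KP.
Qed.

(** For any [s] tending to infinity, [t n = c n / (s n + 1)] is admissible, so eventually
    [t n * S n < 1], that is [S n < (s n + 1) / c n]. A bound valid for every slow [s] yields a
    constant one. *)
Lemma le_div_of_vanishing (S : nat -> \bar R) (c : nat -> {posnum R}) :
  (forall t : nat -> {posnum R},
     (t n)%:num / (c n)%:num @[n --> \oo] --> (0 : R) ->
     ((t n)%:num%:E * S n)%E @[n --> \oo] --> (0%E : \bar R)) ->
  exists C : {posnum R}, \forall n \near \oo,
    (S n <= (C%:num / (c n)%:num)%:E)%E.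
Proof.
move=> H.
have [n k l kl|s sy|K [N _ NP]] := @eventually_not_of_slow_growth
    (fun n k => (k.+1%:R / (c n)%:num)%:E <= S n)%E.
- by apply: le_trans; rewrite lee_fin ler_pM2r// ler_nat ltnS.
- have t_gt0 n : 0 < (c n)%:num / (s n).+1%:R by rewrite divr_gt0.
  pose t n := PosNum (t_gt0 n).
  have tc : (t n)%:num / (c n)%:num @[n --> \oo] --> (0 : R).
    rewrite (_ : (fun n => _) = (fun n => (s n).+1%:R^-1)).
      exact: cvg_inv_nat.
    by apply/funext => n /=; rewrite mulrAC divff ?mul1r.
  have lt01 : (0 < 1%:E :> \bar R)%E by rewrite lte_fin.
  have [N _ NP] := H t tc _ (open_ereal_lt' lt01).
  exists N => //= n Nn; apply/negP; rewrite -ltNge.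
  have := NP n Nn; rewrite /= -lte_pdivlMl// mule1 => /lt_le_trans; apply.
  by rewrite lee_fin invf_div.
- exists (PosNum (ltr0Sn R K)), N => //= n Nn.
  by rewrite leNgt; apply/negP => /ltW; exact: NP.
Qed.

(** The dual argument, with [t n = c n * (s n + 1)] and [t n * S n] eventually above 1. *)
Lemma ge_div_of_diverging (S : nat -> \bar R) (c : nat -> {posnum R}) :
  (forall t : nat -> {posnum R},
     (t n)%:num / (c n)%:num @[n --> \oo] --> +oo ->
     ((t n)%:num%:E * S n)%E @[n --> \oo] --> (+oo%E : \bar R)) ->
  exists C : {posnum R}, \forall n \near \oo,
    ((C%:num^-1 / (c n)%:num)%:E <= S n)%E.
Proof.
move=> H.
have [n k l kl|s sy|K [N _ NP]] := @eventually_not_of_slow_growth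
    (fun n k => S n <= (k.+1%:R^-1 / (c n)%:num)%:E)%E.
- move=> /le_trans; apply; rewrite lee_fin ler_pM2r// lef_pV2 ?posrE//.
  by rewrite ler_nat ltnS.
- have t_gt0 n : 0 < (c n)%:num * (s n).+1%:R by rewrite mulr_gt0.
  pose t n := PosNum (t_gt0 n).
  have tc : (t n)%:num / (c n)%:num @[n --> \oo] --> +oo.
    rewrite (_ : (fun n => _) = (fun n => (s n).+1%:R)); first exact: cvg_natS.
    by apply/funext => n /=; rewrite mulrAC divff ?mul1r.
  have [N _ NP] := (cvgeyPgt _).1 (H t tc) 1.
  exists N => //= n Nn; apply/negP; rewrite -ltNge.
  have := NP n Nn; rewrite -lte_pdivrMl// mule1 => /(le_lt_trans _); apply.
  by rewrite lee_fin /= invfM mulrC.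
- exists (PosNum (ltr0Sn R K)), N => //= n Nn.
  by rewrite leNgt; apply/negP => /ltW; exact: NP.
Qed.

(** Denominators can be cleared: [o n = 0] makes the second quotient [+oo] and [o n = +oo] breaks
    the first bound, so neither occurs for large [n]. *)
Lemma asymp_equivP (o : nat -> \bar R) (r : nat -> {posnum R}) :
  (forall n, 0 <= o n)%E ->
  asymp_equiv o (fun n => (r n)%:num%:E) <->
  exists C : {posnum R}, \forall n \near \oo,
    ((C%:num^-1 * (r n)%:num)%:E <= o n <= (C%:num * (r n)%:num)%:E)%E.
Proof.
move=> o0; split => [[C [N _ NP]]|[C [N _ NP]]].
  have M0 : 0 < Num.max C 1 by rewrite lt_max ltr01 orbT.
  exists (PosNum M0), N => //= n Nn; have [] := NP n Nn.
  rewrite inver gt_eqF// lee_pdivrMr// -EFinM.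
  have := o0 n; case: (o n) => [x| |]; rewrite ?lee_fin => // x0 h1.
  rewrite inver; case: eqVneq => [->|xn0]; first by rewrite gt0_muley ?lte_fin.
  have x_gt0 : 0 < x by rewrite lt_neqAle eq_sym xn0.
  rewrite -EFinM lee_fin ler_pdivrMr// => h2.
  have CM : C <= Num.max C 1 by rewrite le_max lexx.
  rewrite ler_pdivrMl//; apply/andP; split.
    by apply: le_trans h2 _; rewrite ler_wpM2r.
  by apply: le_trans h1 _; rewrite ler_wpM2r.
exists C%:num, N => //= n Nn; have := NP n Nn => /andP[].
rewrite inver gt_eqF// lee_pdivrMr// -EFinM.
case: (o n) => [x| |]//; rewrite !lee_fin => h1 h2; split => //.
have x_gt0 : 0 < x by apply: lt_le_trans h1; rewrite mulr_gt0 ?invr_gt0.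
by rewrite inver gt_eqF// -EFinM lee_fin ler_pdivrMr// -ler_pdivrMl.
Qed.

End Asymptotics.

(** * Critical scales and comparable observable diameters *)

Section PhaseTransition.
Context {R : realType} (P : nat -> set (mmspace R)).
Hypothesis P_neq0 : forall n, P n !=set0.

Let comparable_obs_diam (r : nat -> {posnum R}) := forall kappa : R,
  0 < kappa < 1 -> asymp_equiv (fun n => pyr_obs_diam (P n) kappa)
                               (fun n => (r n)%:num%:E).

Lemma levy_of_comparable (r t : nat -> {posnum R}) : comparable_obs_diam r ->
  (t n)%:num * (r n)%:num @[n --> \oo] --> (0 : R) ->
  levy_family (fun n => pyr_scale (t n) (P n)).
Proof.
move=> cr tr kappa kappa0 kappa1.
(* Half the smaller mass lies strictly below each [kappa i], as the comparison for two sets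
   requires. *)
have k01 : 0 < Num.min (kappa ord0) (kappa ord_max) / 2 < 1.
  rewrite divr_gt0 ?lt_min ?kappa0//= ltr_pdivrMr// gt_min.
  move: kappa1; rewrite !big_ord_recl big_ord0 => h.
  by have h1 := kappa0 (lift ord0 ord0); apply/orP; left; lra.
set k := _ / 2 in k01.
have k_lt i : k < kappa i.
  have [k0 _] := andP k01.
  have : Num.min (kappa ord0) (kappa ord_max) <= kappa i.
    case: i => [[|[|//]] i2]; rewrite ge_min.
      by rewrite (_ : Ordinal i2 = ord0) ?lexx//; exact: val_inj.
    by rewrite (_ : Ordinal i2 = ord_max) ?lexx ?orbT//; exact: val_inj.
  by move: k0; rewrite /k; lra.
have k_lt_sum i : k < \sum_(j | j != i) kappa j.
  have [j ji] : exists j : 'I_2, j != i.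
    by case: i => [[|[|//]] i2]; [exists ord_max|exists ord0].
  rewrite (bigD1 j)//=; apply: ltr_wpDr (k_lt j).
  by apply: sumr_ge0 => l _; exact: ltW.
have [C [N _ NP]] := (asymp_equivP _
  (fun n => pyr_obs_diam_ge0 k (P_neq0 n))).1 (cr k k01).
apply: (@squeeze_cvge _ _ _ _ (fun=> 0%E) _
    (fun n => (C%:num * ((t n)%:num * (r n)%:num))%:E)).
- exists N => //= n Nn; rewrite pyr_sep_scale mule_ge0 ?pyr_sep_ge0//=.
  rewrite mulrCA EFinM; apply: lee_wpmul2l; first by rewrite lee_fin.
  apply: le_trans (pyr_sep_le_obs_diam (P n) _ kappa0 k_lt_sum) _ => //.
  by rewrite mul1e; have /andP[] := NP n Nn.
- exact: cvg_cst.
- apply: cvg_EFin; first exact: nearW.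
  rewrite -[X in _ --> X](mulr0 C%:num); apply: cvgMr; exact: tr.
Qed.

Lemma dissipates_of_comparable (r t : nat -> {posnum R}) :
  comparable_obs_diam r ->
  (t n)%:num * (r n)%:num @[n --> \oo] --> +oo ->
  infty_dissipates (fun n => pyr_scale (t n) (P n)).
Proof.
move=> cr tr N kappa N0 kappa0 kappa1.
have sum0 : 0 <= \sum_i kappa i by apply: sumr_ge0 => i _; exact: ltW.
(* With this [eta] the cutting cost [2 * (N + 1) * eta] is half of the mass left over by [kappa]. *)
pose eta := (1 - \sum_i kappa i) / (4 * N.+1%:R).
have eta0 : 0 < eta by rewrite divr_gt0 ?subr_gt0// mulr_gt0.
have etaE : 4 * N.+1%:R * eta = 1 - \sum_i kappa i.
  by rewrite mulrC divfK// gt_eqF// mulr_gt0.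
have N1 : 1 <= N.+1%:R :> R by rewrite ler1n.
have eta1 : eta < 1.
  have : eta <= N.+1%:R * eta by rewrite ler_peMl// ltW.
  by move: etaE; rewrite -mulrA; lra.
have eta01 : 0 < 1 - eta < 1 by apply/andP; split; lra.
have sum_eta : \sum_i kappa i + 2 * N.+1%:R * eta < 1.
  by move: etaE; rewrite -!mulrA; lra.
have [C [M _ MP]] := (asymp_equivP _
  (fun n => pyr_obs_diam_ge0 (1 - eta) (P_neq0 n))).1 (cr _ eta01).
apply/cvgeyPge => A; have [K _ KP] := (cvgryPge _).1 tr (C%:num * A).
exists (maxn M K) => //= n /=; rewrite geq_max => /andP[Mn Kn].
rewrite pyr_sep_scale.
apply: (@le_trans _ _ ((t n)%:num%:E * (C%:num^-1 * (r n)%:num)%:E)%E).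
  by rewrite -EFinM lee_fin mulrCA ler_pdivlMl//; exact: KP.
apply: lee_wpmul2l; first by rewrite lee_fin.
have /andP[h _] := MP n Mn; apply: le_trans h _.
exact: pyr_obs_diam_le_sep.
Qed.

Lemma comparable_critical (r : nat -> {posnum R}) : comparable_obs_diam r ->
  critical_scale_order P (fun n => ((r n)%:num^-1)%:pos).
Proof.
move=> cr t.
rewrite (_ : (fun n => _) = (fun n => (t n)%:num * (r n)%:num)); last first.
  by apply/funext => n; rewrite /= invrK.
by split; [exact: levy_of_comparable|exact: dissipates_of_comparable].
Qed.

(** The two tail masses [k / 2] sum to [k < 1], so the Levy property applies to the separation that
    dominates the observable diameter. *)
Lemma critical_obs_diam_le (c : nat -> {posnum R}) (k : R) :
  critical_scale_order P c -> 0 < k < 1 ->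
  exists C : {posnum R}, \forall n \near \oo,
    (pyr_obs_diam (P n) k <= (C%:num / (c n)%:num)%:E)%E.
Proof.
move=> cc k01; have [k0 k1] := andP k01.
have [t tc|C [N _ NP]] := @le_div_of_vanishing R
    (fun n => pyr_sep (P n) (fun _ : 'I_2 => k / 2)) c.
  have [levy _] := cc t; have := levy tc (fun _ : 'I_2 => k / 2).
  rewrite !big_ord_recl big_ord0 => h.
  under eq_fun do rewrite -pyr_sep_scale.
  by apply: h => [i|]; lra.
exists C, N => //= n Nn; apply: le_trans (NP n Nn).
exact: pyr_obs_diam_le_sep2.
Qed.

(** Dissipation is applied to [N + 1] equal masses [a]: it needs [(N + 1) * a < 1], while bounding
    their separation by the observable diameter needs [N * a > k]. *)
Lemma critical_obs_diam_ge (c : nat -> {posnum R}) (k : R) :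
  critical_scale_order P c -> 0 < k < 1 ->
  exists C : {posnum R}, \forall n \near \oo,
    ((C%:num^-1 / (c n)%:num)%:E <= pyr_obs_diam (P n) k)%E.
Proof.
move=> cc /andP[k0 k1].
(* [N] is so large that [k / N < 1 / N.+1]; any [a] in between works. *)
have [N N0 kN] : exists2 N : nat, (0 < N)%N & 1 < (1 - k) * N%:R.
  exists (Num.truncn (1 - k)^-1).+1 => //.
  by rewrite -ltr_pdivrMl ?subr_gt0// mulr1; exact: truncnS_gt.
have NR0 : 0 < N%:R :> R by rewrite ltr0n.
have kN1 : k / N%:R < 1 / N.+1%:R.
  by rewrite ltr_pdivrMr// mulrAC ltr_pdivlMr// -(natr1 N); lra.
have [a ka a1] : exists2 a, k / N%:R < a & a < 1 / N.+1%:R.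
  by exists ((k / N%:R + 1 / N.+1%:R) / 2); rewrite midf_lt.
have a0 : 0 < a by apply: lt_trans ka; rewrite divr_gt0.
rewrite ltr_pdivrMr// mulr_natr in ka.
rewrite ltr_pdivlMr// mulr_natr in a1.
have [t tc|C [M _ MP]] := @ge_div_of_diverging R
    (fun n => pyr_sep (P n) (fun _ : 'I_N.+1 => a)) c.
  have [_ diss] := cc t; have := diss tc N (fun _ => a) N0.
  rewrite sumr_const card_ord => h.
  under eq_fun do rewrite -pyr_sep_scale.
  exact: h.
(* The factor [N] absorbs the loss in the comparison of separation with observable diameter. *)
have CN0 : 0 < C%:num * N%:R by rewrite mulr_gt0.
exists (PosNum CN0), M => //= n Mn.
rewrite invfM mulrAC mulrC EFinM lee_pdivrMl//.
apply: le_trans (MP n Mn) _.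
apply: pyr_sep_le_obs_diam => // i.
by rewrite sumr_const cardC1 card_ord.
Qed.

Lemma critical_comparable (c : nat -> {posnum R}) : critical_scale_order P c ->
  comparable_obs_diam (fun n => ((c n)%:num^-1)%:pos).
Proof.
move=> cc k k01.
apply/(asymp_equivP (fun n => ((c n)%:num^-1)%:pos)
  (fun n => pyr_obs_diam_ge0 k (P_neq0 n))).
have [C1 [N1 _ NP1]] := critical_obs_diam_le cc k01.
have [C2 [N2 _ NP2]] := critical_obs_diam_ge cc k01.
exists (C1%:num + C2%:num)%:pos, (maxn N1 N2) => //= n /=.
rewrite geq_max => /andP[/NP1 h1 /NP2 h2]; apply/andP; split.
  apply: le_trans h2; rewrite lee_fin ler_pM2r ?invr_gt0// lef_pV2 ?posrE//.
  by rewrite lerDr.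
by apply: le_trans h1 _; rewrite lee_fin ler_pM2r ?invr_gt0// lerDl.
Qed.

End PhaseTransition.

Theorem theorem1p2 (R : realType) (P : nat -> set (mmspace R))
    (hP : forall n, pyramid (P n)) :
  (phase_transition_property P <->
   exists r : nat -> {posnum R}, forall kappa : R, 0 < kappa < 1 ->
     asymp_equiv (fun n => pyr_obs_diam (P n) kappa)
                 (fun n => (r n)%:num%:E)) /\
  (forall r : nat -> {posnum R},
     (forall kappa : R, 0 < kappa < 1 ->
        asymp_equiv (fun n => pyr_obs_diam (P n) kappa)
                    (fun n => (r n)%:num%:E)) ->
     critical_scale_order P (fun n => ((r n)%:num^-1)%:pos)).
Proof.
have P_neq0 n : P n !=set0 by have [] := hP n.
split; [split=> [[c cc]|[r cr]]|].
- by eexists; exact: critical_comparable cc.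
- by eexists; exact: comparable_critical cr.
- by move=> r; exact: comparable_critical.
Qed.
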